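(* If the affine index polynomial $P(t)$ of a virtual knot is not symmetric with respect to $t\leftrightarrow t^{-1}$ (that is, $P(t)\neq P(t^{-1})$), then this virtual knot is not the virtual closure of a knotoid in $S^2$.
   Context: A knotoid diagram in $S^2$ is a generic immersion of $[0,1]$ into the oriented sphere $S^2$ whose only singularities are finitely many transversal double points with over/under information (classical crossings). The images of $0$ and $1$ (tail and head) are distinct from each other and from the crossings; the diagram is oriented from tail to head. Two such diagrams are equivalent if related by finitely many Reidemeister moves $\Omega_1,\Omega_2,\Omega_3$ performed inside small disks not containing the endpoints, and isotopy of $S^2$; a knotoid in $S^2$ is an equivalence class. A virtual knot diagram is a closed oriented curve diagram in $S^2$ with classical crossings and virtual crossings (transversal double points with no over/under information). Virtual knots are classes of such diagrams under isotopy of $S^2$, the Reidemeister moves and the detour move (a segment whose crossings are all virtual may be replaced by any other segment with the same ends, all of whose crossings with the rest of the diagram are declared virtual). Virtual closure. Given a knotoid diagram $K$ in $S^2$, connect its head to its tail by an arc embedded in $S^2$ (in general position with respect to the diagram), declaring every crossing of this arc with the diagram to be virtual. The resulting virtual knot depends only on the knotoid $K$ and is called the virtual closure $\overline{v}(K)$. Affine index polynomial of a virtual knot. Take an oriented diagram and forget the over/under information at classical crossings to get a flat virtual diagram. Its arcs are the edges between consecutive flat (formerly classical) crossings; virtual crossings are not vertices. Label one arc by an arbitrary integer and the others by the rule: at each flat crossing, drawn with both strands oriented upwards, the strand going from bottom right to top left has its label increased by $1$ and the strand going from bottom left to top right has its label decreased by $1$; labels do not change at virtual crossings. (Such a labeling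 exists and is unique up to a global additive constant.) For a classical crossing $c$ let $a$ and $b$ be the labels of the left and right incoming arcs, and set $w_+(c)=a-(b+1)$, $w_-(c)=b-(a-1)$; let $w(c)=w_+(c)$ if $c$ is positive and $w(c)=w_-(c)$ if $c$ is negative. Then $P(t)=\sum_c\mathrm{sgn}(c)(t^{w(c)}-1)\in\mathbb{Z}[t,t^{-1}]$, the sum over all classical crossings; it is an invariant of the virtual knot. *)

(* Defs.v *)
From HB Require Import structures.
From Stdlib Require Import Relation_Operators.
From mathcomp Require Import all_boot all_order all_algebra.
From mathcomp Require Import finmap monalg.

Set Implicit Arguments.
Unset Strict Implicit.
Unset Printing Implicit Defensive.

Import GRing.Theory.

(* A generic curve on the oriented sphere is recorded by the list of its      *)
(* passes through its double points, in the order of traversal.  The image of *)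
(* a curve is connected, so as soon as there is a double point or an endpoint *)
(* the diagram is a cellular map on S^2, determined up to isotopy of S^2 by   *)
(* the cyclic order of the edges around each double point; for two oriented   *)
(* transversal strands this is one bit, [rtl] below.  For a closed curve the  *)
(* list starts at an auxiliary base point, treated as a vertex of degree 2.   *)

(* One pass of the curve through the double point [name].                     *)
(*   level = Some true  : classical crossing, this strand is the over strand  *)
(*   level = Some false : classical crossing, this strand is the under strand *)
(*   level = None       : virtual crossing                                    *)
(*   rtl                : seen along this strand, the other strand crosses    *)
(*                        from right to left                                  *)
Record pass := Pass { name : nat; level : option bool; rtl : bool }.

Definition code_pass p := (name p, level p, rtl p).
Definition decode_pass c := Pass c.1.1 c.1.2 c.2.
Lemma code_passK : cancel code_pass decode_pass. Proof. by case. Qed.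
HB.instance Definition _ := Countable.copy pass (can_type code_passK).

Definition virtual (p : pass) := level p == None.
Definition over (p : pass) := level p == Some true.

(* The other pass through the same double point. *)
Definition opp (p : pass) : pass :=
  Pass (name p) (omap negb (level p)) (~~ rtl p).

Definition wf (w : seq pass) : bool :=
  uniq w && all (fun p => (opp p \in w)
                          && (count (fun q => name q == name p) w == 2)) w.

(* With m = size w, the curve is cut by its passes into edges 0, ..., m; edge *)
(* i arrives at the i-th pass and edge i.+1 leaves it.  Edge 0 starts at the  *)
(* tail and edge m ends at the head ([closed] = false), or both are attached  *)
(* to the base point ([closed] = true).  A dart (i, true), resp. (i, false),  *)
(* is edge i traversed forwards, resp. backwards.  [turn] follows the         *)
(* boundary of the face lying to the left of a dart: at a double point it     *)
(* turns left, that is, it follows the other strand, forwards if this one     *)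
(* goes from right to left as seen along the direction of travel.             *)
Definition turn (closed : bool) (w : seq pass) (d : nat * bool) : nat * bool :=
  let across p fwd :=
    let b := rtl p == fwd in (index (opp p) w + b, b) in
  match d with
  | (i, true) =>
      if i < size w then across (nth (Pass 0 None false) w i) true
      else if closed then (0, true) else (i, false)
  | (k.+1, false) => across (nth (Pass 0 None false) w k) false
  | (0, false) => if closed then (size w, false) else (0, true)
  end.

Definition dart (w : seq pass) : finType := ('I_(size w).+1 * bool)%type.

Definition turn_dart closed w (d : dart w) : dart w :=
  let e := turn closed w (val d.1, d.2) in (inord e.1, e.2).

Definition faces closed w : nat := fcard (turn_dart closed (w := w)) (dart w).

(* Euler's formula V + F = E + 2: the surface carrying the diagram is S^2.    *)
Definition spherical (closed : bool) (w : seq pass) : bool :=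
  let V := (size w)./2 + (if closed then 1 else 2) in
  let E := (size w).+1 in
  V + faces closed w == E + 2.

Record knotoid_diagram := KnotoidDiagram {
  kd_word :> seq pass;
  kd_wf : wf kd_word;
  kd_spherical : spherical false kd_word;
  kd_classical : all (fun p => ~~ virtual p) kd_word }.

Record virtual_diagram := VirtualDiagram {
  vd_word :> seq pass;
  vd_wf : wf vd_word;
  vd_spherical : spherical true vd_word }.

Definition rename (f : nat -> nat) (p : pass) : pass :=
  Pass (f (name p)) (level p) (rtl p).

(* Sphericity of both sides of a move is imposed by the types of diagrams.    *)
(* - The loop created by a move R1 always bounds a face.                      *)
(* - In R2 the opposite values of [rtl] make the two new edges bound a face,  *)
(*   one strand being over at both new crossings; the second strand may run   *)
(*   parallel or antiparallel to the first.                                   *)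
(* - In R3 the three middle edges bound a face, and one of the strands is     *)
(*   over the two others (so that one of these is below the two others).      *)
Inductive reidemeister (closed : bool) : seq pass -> seq pass -> Prop :=
| R1 a b p : ~~ virtual p ->
    reidemeister closed (a ++ b) (a ++ [:: p; opp p] ++ b)
| R2 a b c p q s : ~~ virtual p -> level q = level p -> rtl q = ~~ rtl p ->
    s = [:: opp p; opp q] \/ s = [:: opp q; opp p] ->
    reidemeister closed (a ++ b ++ c) (a ++ [:: p; q] ++ b ++ s ++ c)
| R3 a b c d p p' q q' r r' (w := a ++ [:: p; p'] ++ b ++ [:: q; q'] ++ c
                                    ++ [:: r; r'] ++ d) s t u :
    let i := (size a).+1 in
    let j := (size (a ++ [:: p; p'] ++ b)).+1 in
    let k := (size (a ++ [:: p; p'] ++ b ++ [:: q; q'] ++ c)).+1 in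
    fcycle (turn closed w) [:: (i, s); (j, t); (k, u)]
      \/ fcycle (turn closed w) [:: (i, s); (k, u); (j, t)] ->
    all (fun x => ~~ virtual x) [:: p; p'; q; q'; r; r'] ->
    [|| over p && over p', over q && over q' | over r && over r'] ->
    reidemeister closed w
      (a ++ [:: p'; p] ++ b ++ [:: q'; q] ++ c ++ [:: r'; r] ++ d).

Inductive knotoid_move (K K' : knotoid_diagram) : Prop :=
| KMrename f : injective f -> kd_word K' = map (rename f) K -> knotoid_move K K'
| KMreidemeister : reidemeister false K K' -> knotoid_move K K'.

(* Remove from [u] all double points lying on the segment [s]. *)
Definition erase (s u : seq pass) : seq pass :=
  [seq p <- u | name p \notin map name s].

(* In a detour move u ++ s ~> u' ++ s', the segment s, all of whose crossings *)
(* are virtual, is replaced by s'; removing either segment leaves the same    *)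
(* open curve, hence by the remark above the same picture on S^2.             *)
Inductive virtual_move (D D' : virtual_diagram) : Prop :=
| VMrename f : injective f -> vd_word D' = map (rename f) D -> virtual_move D D'
| VMbase k : vd_word D' = rot k D -> virtual_move D D'
| VMreidemeister : reidemeister true D D' -> virtual_move D D'
| VMdetour u s u' s' : vd_word D = u ++ s -> vd_word D' = u' ++ s' ->
    all virtual s -> all virtual s' -> erase s u = erase s' u' ->
    virtual_move D D'.

Definition knotoid_equiv := clos_refl_sym_trans knotoid_diagram knotoid_move.
Definition virtual_equiv := clos_refl_sym_trans virtual_diagram virtual_move.

Record knotoid := Knotoid {
  k_diagrams :> knotoid_diagram -> Prop;
  k_class : exists K, forall K', k_diagrams K' <-> knotoid_equiv K K' }.

Record virtual_knot := VirtualKnot {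
  v_diagrams :> virtual_diagram -> Prop;
  v_class : exists D, forall D', v_diagrams D' <-> virtual_equiv D D' }.

(* D is K together with an embedded arc [s] from the head to the tail, all    *)
(* of whose crossings are virtual.  The base point of D is the tail of K; the *)
(* passes of K through the arc are interspersed among those of K in [u].      *)
Definition closure_diagram (K : knotoid_diagram) (D : virtual_diagram) : Prop :=
  exists u s, [/\ vd_word D = u ++ s, all virtual s, uniq (map name s)
                & erase s u = kd_word K].

Definition is_virtual_closure (k : knotoid) (v : virtual_knot) : Prop :=
  exists K D, [/\ k K, closure_diagram K D & v D].

Local Open Scope ring_scope.

(* A strand going from bottom right to top left is crossed from left to       *)
(* right, and then its label increases.                                       *)
Definition label_step (p : pass) : int :=
  if virtual p then 0 else if rtl p then -1 else 1.

(* [l i] is the label of edge i. *)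
Definition labeling (w : seq pass) (l : nat -> int) : Prop :=
  (forall i, (i < size w)%N ->
     l i.+1 = l i + label_step (nth (Pass 0 None false) w i))
  /\ l (size w) = l 0%N.

Definition incoming (w : seq pass) (l : nat -> int) (p : pass) : int :=
  l (index p w).

(* With both strands drawn upwards, the strand entering on the left is the    *)
(* one which is crossed from right to left; the crossing is positive when     *)
(* this is the over strand.  A classical crossing is represented here by its  *)
(* over pass [p].                                                             *)
Definition crossing_sign (p : pass) : int := if rtl p then 1 else -1.

Definition weight (w : seq pass) (l : nat -> int) (p : pass) : int :=
  let a := incoming w l (if rtl p then p else opp p) in
  let b := incoming w l (if rtl p then opp p else p) in
  if rtl p then a - (b + 1) else b - (a - 1).

(* Z[t, t^-1] as the free Z-module on the powers of t: << c *g n >> is the    *)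
(* monomial c t^n and P@_n is the coefficient of t^n in P.                    *)
Definition laurent := {malg int[int]}.

(* P(t^-1) *)
Definition laurent_inv (P : laurent) : laurent :=
  \sum_(n <- msupp P) << P@_n *g - n >>.

Definition affine_index (w : seq pass) (l : nat -> int) : laurent :=
  \sum_(p <- w | over p)
    (<< crossing_sign p *g weight w l p >> - << crossing_sign p *g 0 >>).

Definition affine_index_polynomial (v : virtual_knot) (P : laurent) : Prop :=
  exists (D : virtual_diagram) (l : nat -> int),
    [/\ v D, labeling D l & P = affine_index D l].

(* Main.v *)
(** The weight of a crossing is determined by the passes through the classical
    crossings alone, so the polynomial of a virtual closure can be computed from
    the knotoid diagram [w] itself.  There, with [h] the labels of the edges,
    [a] and [b] the incoming labels of a crossing and [t] an invertible element
    of a field, the claim is that the sum over all crossings of [t^(a-b-1)]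
    equals that of [t^(b+1-a)].

    The labels describe the lift of the curve to the infinite cyclic cover of
    the sphere minus the two endpoints, an infinite strip.  Each lift separates the
    strip, hence there is a function [F] on the faces, with values in the
    field (a generating series over the sheets), such that
    [t^-1 F(right of e) - F(left of e) = t^(- h e)] for each edge [e].  Its
    existence is a dimension count: the twisted cochain complex
    faces -> edges -> crossings is injective on the left and surjective on the
    right, so by Euler's formula it is exact if [t <> 1].  At the two ends of
    the curve left and right faces coincide, which determines [F] there.  Along
    the curve [t^(h e) F(left of e)] changes at each pass by a signed power of
    [t], and the telescoping sum of these changes is the claimed identity. *)
From mathcomp Require Import all_boot all_order all_algebra.
From mathcomp Require Import finmap monalg zify ring.
Require Import Defs.

Set Implicit Arguments.
Unset Strict Implicit.
Unset Printing Implicit Defensive.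

Import Order.TTheory GRing.Theory Num.Theory.

Local Open Scope ring_scope.

Local Notation nth_pass := (nth (Pass 0 None false)).

(** * Heights and loop indices *)

Lemma oppK : involutive opp.
Proof. by case=> n [[]|] []. Qed.

Lemma opp_neq p : opp p != p.
Proof. by apply/eqP => /(congr1 rtl) /=; case: (rtl p). Qed.

Lemma virtual_opp p : virtual (opp p) = virtual p.
Proof. by case: p => n [[]|] b. Qed.

Lemma over_classical p : over p -> ~~ virtual p.
Proof. by case: p => n [[]|] b. Qed.

Lemma over_opp p : ~~ virtual p -> over (opp p) = ~~ over p.
Proof. by case: p => n [[]|] b. Qed.

Lemma label_step_opp p : label_step (opp p) = - label_step p.
Proof. by case: p => n [[]|] []. Qed.

Lemma crossing_sign_opp p : crossing_sign (opp p) = - crossing_sign p.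
Proof. by case: p => n [[]|] []. Qed.

Lemma wf_uniq w : wf w -> uniq w.
Proof. by case/andP. Qed.

Lemma wf_opp w p : wf w -> (opp p \in w) = (p \in w).
Proof.
case/andP=> _ /allP wfw; apply/idP/idP => [/wfw|/wfw] /andP[//].
by rewrite oppK.
Qed.

Lemma wf_perm_opp w : wf w -> perm_eq (map opp w) w.
Proof.
move=> wfw; have uw := wf_uniq wfw; apply: uniq_perm => //.
  by rewrite map_inj_uniq //; apply: inv_inj oppK.
by move=> p; rewrite -{1}[p]oppK (mem_map (inv_inj oppK)) wf_opp.
Qed.

(** A third pass besides [p] and [opp p] would contradict the count 2 in [wf]. *)
Lemma wf_same_name w p q : wf w -> p \in w -> q \in w -> name q = name p ->
  q = p \/ q = opp p.
Proof.
move=> wfw pw qw eqn; have [_ /allP/(_ _ pw)/andP[ow /eqP c2]] := andP wfw.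
case: (q =P p) => [|/eqP qp]; first by left.
case: (q =P opp p) => [|/eqP qo]; first by right.
have /uniq_leq_size : uniq [:: p; opp p; q].
  by rewrite /= !inE negb_or eq_sym opp_neq /= eq_sym qp eq_sym qo.
suff sub : {subset [:: p; opp p; q] <= [seq x <- w | name x == name p]}.
  by move/(_ _ sub); rewrite size_filter c2.
move=> x; rewrite !inE mem_filter => /or3P[] /eqP-> ;
  rewrite ?pw ?ow ?qw ?eqn eqxx //.
Qed.

(** The label of the edge arriving at [x], normalised to 0 on the first edge; for [x] outside [w] it
    is [total w]. Indexing by passes rather than positions lets words be compared before and after a
    move. *)
Fixpoint height (w : seq pass) (x : pass) : int :=
  if w is y :: w' then if y == x then 0 else label_step y + height w' x else 0.

Definition total (w : seq pass) : int := \sum_(y <- w) label_step y.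

Lemma height_cat u v x :
  height (u ++ v) x = if x \in u then height u x else total u + height v x.
Proof.
rewrite /total; elim: u => [|y u IHu] /=; first by rewrite big_nil add0r.
rewrite inE big_cons IHu eq_sym; case: eqP => //= _.
by case: ifP => // _; rewrite addrA.
Qed.

Lemma total_cat u v : total (u ++ v) = total u + total v.
Proof. exact: big_cat. Qed.

Lemma height_mid u x v : uniq (u ++ x :: v) -> height (u ++ x :: v) x = total u.
Proof.
rewrite uniq_catC height_cat /= eqxx addr0 mem_cat negb_or => /andP[/andP[_ xu] _].
by rewrite (negPf xu).
Qed.

(** [opp] permutes the passes and negates every step. *)
Lemma total_wf w : wf w -> total w = 0.
Proof.
move=> wfw; have: total w = - total w.
  rewrite {1}/total -(perm_big _ (wf_perm_opp wfw)) big_map -sumrN.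
  by apply: eq_bigr => p _; rewrite label_step_opp.
lia.
Qed.

(** At the over pass this is the weight of the crossing, [w_+] if [rtl p] and [w_-] otherwise. If
    [total w = 0], it is minus the sum of the steps strictly between [p] and [opp p] along the
    closed curve. *)
Definition loop_index (w : seq pass) (p : pass) : int :=
  height w p + label_step p - height w (opp p).

Definition crossing_term (w : seq pass) (p : pass) : laurent :=
  << crossing_sign p *g loop_index w p >> - << crossing_sign p *g 0 >>.

Definition index_poly (w : seq pass) : laurent :=
  \sum_(p <- w | over p) crossing_term w p.

Lemma loop_index_opp w p : loop_index w (opp p) = - loop_index w p.
Proof. rewrite /loop_index label_step_opp oppK; lia. Qed.

Lemma loop_index_shift w w' p s : height w' p = height w p + s ->
  height w' (opp p) = height w (opp p) + s -> loop_index w' p = loop_index w p.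
Proof. by rewrite /loop_index => -> ->; lia. Qed.

Lemma labeling_height w l p : labeling w l -> p \in w ->
  l (index p w) = l 0%N + height w p.
Proof.
case=> + _; elim: w l => // y w IHw l lw; rewrite inE /=.
rewrite eq_sym; case: eqP => [_ _|_ /= pw]; first by rewrite addr0.
rewrite -[l _]/((l \o succn) _) (IHw (l \o succn)) //= => [|i lt_i];
  last exact: (lw i.+1).
by rewrite (lw 0%N) // addrA.
Qed.

(** Labels and heights differ by the constant [l 0], which cancels in [a - b]. *)
Lemma affine_indexE w l : wf w -> labeling w l -> affine_index w l = index_poly w.
Proof.
move=> wfw lab; rewrite /affine_index /index_poly big_seq_cond [RHS]big_seq_cond.
apply: eq_bigr => p /andP[pw op]; congr (<< _ *g _ >> - _).
rewrite /weight /incoming /loop_index.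
have := labeling_height lab pw.
have /(labeling_height lab) : opp p \in w by rewrite wf_opp.
rewrite /label_step (negPf (over_classical op)); case: ifP; lia.
Qed.

Lemma eq_index_poly w w' : perm_eq w w' ->
  {in w, forall p, over p -> loop_index w p = loop_index w' p} ->
  index_poly w = index_poly w'.
Proof.
move=> ww' eqW; rewrite /index_poly -(perm_big _ ww') /= big_seq_cond.
rewrite [RHS]big_seq_cond; apply: eq_bigr => p /andP[pw op].
by rewrite /crossing_term eqW.
Qed.

(** * Virtual crossings, renaming and change of base point *)

Definition classical_part (w : seq pass) := [seq p <- w | ~~ virtual p].

Lemma height_classical w x : ~~ virtual x ->
  height (classical_part w) x = height w x.
Proof.
move=> cx; elim: w => //= y w IHw; case: ifPn => /= [cy|]; first by rewrite IHw.
rewrite negbK => vy; rewrite IHw /label_step vy add0r.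
by case: eqP vy cx => // -> ->.
Qed.

Lemma index_poly_classical w : index_poly (classical_part w) = index_poly w.
Proof.
rewrite /index_poly big_filter_cond; apply: eq_big => [p|p /andP[cp _]].
  by rewrite andbC; case: (boolP (over p)) => // /over_classical->.
by rewrite /crossing_term /loop_index !height_classical ?virtual_opp.
Qed.

(** [erase] works by names, but a pass of [u] sharing its name with a pass of [s] is virtual too, so
    no classical pass is lost. *)
Lemma classical_part_erase u s : wf (u ++ s) -> all virtual s ->
  classical_part (erase s u) = classical_part (u ++ s).
Proof.
move=> wfw /allP vs; rewrite /classical_part filter_cat.
have -> : [seq p <- s | ~~ virtual p] = [::].
  by apply/eqP; rewrite -(negbK (_ == _)) -has_filter; apply/hasPn => p /vs->.
rewrite cats0 -filter_predI; apply: eq_in_filter => q qu /=.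
case: (boolP (virtual q)) => //= cq; apply/mapP=> -[p ps eqn].
have pw : p \in u ++ s by rewrite mem_cat ps orbT.
have qw : q \in u ++ s by rewrite mem_cat qu.
have [eqp|eqp] := wf_same_name wfw pw qw eqn; move: cq; rewrite eqp ?virtual_opp vs //.
Qed.

Section Rename.
Variables (f : nat -> nat) (inj_f : injective f).

Lemma rename_inj : injective (rename f).
Proof. by case=> n l b [n' l' b'] [/inj_f-> -> ->]. Qed.

Lemma height_rename w x : height (map (rename f) w) (rename f x) = height w x.
Proof. by elim: w => //= y w ->; rewrite (inj_eq rename_inj). Qed.

Lemma index_poly_rename w : index_poly (map (rename f) w) = index_poly w.
Proof.
rewrite /index_poly big_map; apply: eq_bigr => p _.
rewrite /crossing_term /loop_index.
have -> : opp (rename f p) = rename f (opp p) by case: p.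
by rewrite !height_rename.
Qed.
End Rename.

Lemma index_poly_rot k w : wf w -> index_poly (rot k w) = index_poly w.
Proof.
move=> wfw; apply: eq_index_poly => [|p]; first by rewrite perm_rot.
rewrite mem_rot => pw _; have := total_wf wfw; have := wf_uniq wfw.
have: opp p \in w by rewrite wf_opp.
(* All heights shift by the same constant; for the passes carried from the front to the back this
   uses [total w = 0]. *)
have heightE x : x \in w -> uniq w -> total w = 0 ->
    height (rot k w) x = height w x - total (take k w).
  rewrite /rot; move: (take k w) (drop k w) (cat_take_drop k w) => u v <-.
  rewrite mem_cat cat_uniq total_cat !height_cat.
  case: (boolP (x \in u)) => /= [xu _ /and3P[_ /hasPn nuv _]|_ -> _]; last lia.
  by case: ifPn => [/nuv|_]; rewrite /= ?xu //; lia.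
by move=> ow uw tot; rewrite /loop_index !heightE //; lia.
Qed.

(** * Invariance under the moves *)

Lemma height_insert a z b x : total z = 0 -> x \notin z ->
  height (a ++ z ++ b) x = height (a ++ b) x.
Proof.
by move=> tz /negPf xz; rewrite !height_cat xz tz add0r; case: ifP.
Qed.

Lemma height_swap a b p q x : uniq (a ++ [:: p; q]) ->
  height (a ++ [:: q; p] ++ b) x = height (a ++ [:: p; q] ++ b) x
   + (if x == p then label_step q else if x == q then - label_step p else 0).
Proof.
rewrite uniq_catC /= !inE !negb_or => /and3P[/andP[pq pa] qa _].
rewrite !height_cat /=; case: (boolP (x \in a)) => xa.
  by case: eqP xa pa => [-> ->|_ xa _] //; case: eqP xa qa => [-> ->|_]; rewrite ?addr0.
rewrite ?inE !(eq_sym x); case: (p =P x) pq => [<-|_].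
  by rewrite eq_sym => /negPf->; rewrite ?eqxx /=; lia.
case: (q =P x) => [_ _|_ _] /=; first by rewrite ?eqxx; lia.
by lia.
Qed.

(** Common part of R1 and R2: [z] collects the inserted passes, and every other crossing keeps both
    of its heights. *)
Lemma index_poly_insert z w w0 : uniq w -> perm_eq w (z ++ w0) ->
  (forall x, x \notin z -> height w x = height w0 x) ->
  {in z, forall x, opp x \in z} ->
  \sum_(p <- z | over p) crossing_term w p = 0 -> index_poly w = index_poly w0.
Proof.
move=> uw ww0 hE oz sz0; rewrite /index_poly (perm_big _ ww0) big_cat /= sz0 add0r.
rewrite big_seq_cond [RHS]big_seq_cond; apply: eq_bigr => x /andP[xw0 _].
have xz : x \notin z.
  by move: uw; rewrite (perm_uniq ww0) cat_uniq => /and3P[_ /hasPn/(_ _ xw0)].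
have xoz : opp x \notin z by apply: contra xz => /oz; rewrite oppK.
by rewrite /crossing_term /loop_index !hE.
Qed.

(** Nothing lies on the new loop, so its index is 0 and its term is a multiple of [t^0 - 1]. *)
Lemma index_poly_R1 a b p : wf (a ++ [:: p; opp p] ++ b) ->
  index_poly (a ++ [:: p; opp p] ++ b) = index_poly (a ++ b).
Proof.
move=> wfw; set w := a ++ _.
have Wp : loop_index w p = 0.
  move: (wf_uniq wfw); rewrite cat_uniq /= negb_or => /and3P[_ /andP[pa]].
  rewrite negb_or => /andP[oa _] _.
  rewrite /loop_index /w !height_cat (negPf pa) (negPf oa) !inE /= !eqxx /= orbT.
  rewrite eq_sym (negPf (opp_neq p)); lia.
apply: (@index_poly_insert [:: p; opp p]) (wf_uniq wfw) _ _ _ _.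
- by rewrite perm_catCA.
- move=> x; apply: height_insert.
  by rewrite /total !big_cons big_nil label_step_opp; lia.
- by move=> x; rewrite !inE => /orP[] /eqP->; rewrite ?oppK eqxx ?orbT.
- rewrite big1_seq // => x /andP[_]; rewrite !inE => /orP[] /eqP->.
    by rewrite /crossing_term Wp subrr.
  by rewrite /crossing_term loop_index_opp Wp oppr0 subrr.
Qed.

(** The pair [(x, y)] is the order in which the second strand meets the crossings, covering the
    parallel and the antiparallel case. *)
Lemma R2_loop_index a b c p q x y :
  label_step q = - label_step p ->
  (x, y) = (p, q) \/ (x, y) = (q, p) ->
  let w := a ++ [:: p; q] ++ b ++ [:: opp x; opp y] ++ c in
  uniq w -> loop_index w q = loop_index w p.
Proof.
move=> sq xy w uw; have hp : height w p = total a by apply: (@height_mid a p _ uw).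
have hq : height w q = total a + label_step p.
  have wE : w = (a ++ [:: p]) ++ q :: b ++ [:: opp x; opp y] ++ c by rewrite -catA.
  by rewrite wE height_mid -?wE // total_cat /total big_seq1.
have totpq : total [:: p; q] = 0 by rewrite /total !big_cons big_nil; lia.
have hx : height w (opp x) = total a + total b.
  have wE : w = (a ++ [:: p; q] ++ b) ++ opp x :: opp y :: c by rewrite -!catA.
  by rewrite wE height_mid -?wE // !total_cat totpq add0r.
have hy : height w (opp y) = total a + total b - label_step x.
  have wE : w = (a ++ [:: p; q] ++ b ++ [:: opp x]) ++ opp y :: c by rewrite -!catA.
  rewrite wE height_mid -?wE // !total_cat totpq /total big_seq1 label_step_opp; lia.
by rewrite /loop_index; case: xy => -[xE yE]; subst x y; lia.
Qed.

(** The two new crossings have equal index and opposite signs, so their terms cancel. *)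
Lemma index_poly_R2 a b c p q s : ~~ virtual p -> level q = level p ->
  rtl q = ~~ rtl p -> s = [:: opp p; opp q] \/ s = [:: opp q; opp p] ->
  wf (a ++ [:: p; q] ++ b ++ s ++ c) ->
  index_poly (a ++ [:: p; q] ++ b ++ s ++ c) = index_poly (a ++ b ++ c).
Proof.
move=> cp lq rq sE wfw; set w := a ++ _.
have uw := wf_uniq wfw.
have vE : virtual q = virtual p by rewrite /virtual lq.
have oE : over q = over p by rewrite /over lq.
have stq : label_step q = - label_step p.
  by rewrite /label_step vE rq; case: (virtual p); case: (rtl p).
have sgq : crossing_sign q = - crossing_sign p.
  by rewrite /crossing_sign rq; case: (rtl p).
have tots : total s = 0.
  by case: sE => ->; rewrite /total !big_cons big_nil !label_step_opp; lia.
have Wq : loop_index w q = loop_index w p.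
  by move: uw; rewrite /w; case: sE => -> ; apply: R2_loop_index => //; [left|right].
apply: (@index_poly_insert ([:: p; q] ++ s)) (uw) _ _ _ _.
- by rewrite perm_catCA -catA perm_cat2l (catA a b (s ++ c)) (perm_catCA (a ++ b)) -catA.
- move=> x; rewrite mem_cat negb_or => /andP[xpq xs].
  rewrite height_insert //; last by rewrite /total !big_cons big_nil; lia.
  by rewrite (catA a) height_insert // -catA.
- by move=> x; case: sE => ->; rewrite !inE => /or4P[] /eqP->; rewrite ?oppK eqxx ?orbT.
have -> : \sum_(x <- [:: p; q] ++ s | over x) crossing_term w x =
    \sum_(x <- [:: p; q; opp p; opp q] | over x) crossing_term w x.
  by apply: perm_big; case: sE => -> //; rewrite !perm_cons (perm_catC [:: _] [:: _]).
rewrite !big_cons big_nil !over_opp ?vE // oE.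
rewrite /crossing_term !loop_index_opp !crossing_sign_opp Wq sgq !monalgUN.
by case: (over p); rewrite /= addr0 addrACA !subrr addr0.
Qed.

(** Edge [i] runs from pass [i.-1] to pass [i]; hence [en] is the pass at the end of the dart
    [(i, s)]. The bounds exclude the first and the last edge, where a turn may meet no crossing. *)
Lemma turn_opp closed w i j (s t : bool) : wf w ->
  (0 < i < size w)%N -> (0 < j < size w)%N -> turn closed w (i, s) = (j, t) ->
  let en := nth_pass w (if s then i else i.-1) in
  nth_pass w (if t then j.-1 else j) = opp en /\ t = (rtl en == s).
Proof.
move=> wfw /andP[i0 iw] /andP[j0 jw].
have nthE k (b : bool) : (k < size w)%N ->
    (index (opp (nth_pass w k)) w + b, b)%N = (j, t) ->
    nth_pass w (if t then j.-1 else j) = opp (nth_pass w k).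
  move=> kw [<- <-]; case: b; rewrite /= ?addn1 ?addn0 /= nth_index // wf_opp //;
  exact: mem_nth.
case: i i0 iw => // k _ kw; rewrite /turn; case: s => [|eqj].
  by rewrite kw => eqj; split; [exact: nthE kw eqj | case: eqj].
by split; [exact: nthE (ltnW kw) eqj | case: eqj].
Qed.

(* For the middle edges of a triangular face, traversed in the direction [s],
   [t], [u], a turn to the left at the end of one edge leads to the start of the
   next, which fixes the sign of each crossing in terms of these directions. *)
Lemma R3_shift (f : pass -> int) p p' q q' r r' (s t u : bool) :
  let en1 := if s then p' else p in let st1 := if s then p else p' in
  let en2 := if t then q' else q in let st2 := if t then q else q' in
  let en3 := if u then r' else r in let st3 := if u then r else r' in
  all (fun x => ~~ virtual x) [:: p; p'; q; q'; r; r'] ->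
  [/\ f p = label_step p', f q = label_step q' & f r = label_step r'] ->
  [/\ f p' = - label_step p, f q' = - label_step q & f r' = - label_step r] ->
  st2 = opp en1 /\ t = (rtl en1 == s) -> st3 = opp en2 /\ u = (rtl en2 == t) ->
  st1 = opp en3 /\ s = (rtl en3 == u) ->
  {in [:: p; p'; q; q'; r; r'], forall x,
    (opp x \in [:: p; p'; q; q'; r; r']) && (f x == f (opp x))}.
Proof.
move=> en1 st1 en2 st2 en3 st3 /and5P[cp cp' cq cq' /and3P[cr cr' _]].
move=> [fp fq fr] [fp' fq' fr'].
move=> [e1 d1] [e2 d2] [e3 d3].
have stepE x (s1 s2 : bool) : ~~ virtual x -> s2 = (rtl x == s1) ->
    label_step x = if s2 == s1 then -1 else 1.
  by rewrite /label_step => /negPf->; case: (rtl x) s1 s2 => [] [] [].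
have step1 : label_step en1 = if t == s then -1 else 1.
  by apply: stepE d1; rewrite /en1; case: (s).
have step2 : label_step en2 = if u == t then -1 else 1.
  by apply: stepE d2; rewrite /en2; case: (t).
have step3 : label_step en3 = if s == u then -1 else 1.
  by apply: stepE d3; rewrite /en3; case: (u).
have fen1 : f en1 = if s then - label_step st1 else label_step st1.
  by rewrite /en1 /st1; case: (s).
have fen2 : f en2 = if t then - label_step st2 else label_step st2.
  by rewrite /en2 /st2; case: (t).
have fen3 : f en3 = if u then - label_step st3 else label_step st3.
  by rewrite /en3 /st3; case: (u).
have fst1 : f st1 = if s then label_step en1 else - label_step en1.
  by rewrite /en1 /st1; case: (s).
have fst2 : f st2 = if t then label_step en2 else - label_step en2.
  by rewrite /en2 /st2; case: (t).
have fst3 : f st3 = if u then label_step en3 else - label_step en3.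
  by rewrite /en3 /st3; case: (u).
have six x : (x \in [:: p; p'; q; q'; r; r'])
    = (x \in [:: en1; st2; en2; st3; en3; st1]).
  rewrite !inE /en1 /st1 /en2 /st2 /en3 /st3.
  by case: (s); case: (t); case: (u); case: (x == p); case: (x == p');
     case: (x == q); case: (x == q'); case: (x == r); case: (x == r').
(* The passes [en1] and [st2] form one corner of the triangle. Each shift is, up to sign, the step
   at the opposite end of its side, a crossing with the third side; both signs are given by the
   directions. *)
have f1 : f en1 = f st2.
  by rewrite fen1 fst2 {1 2}e3 label_step_opp step2 step3;
     case: (s); case: (t); case: (u).
have f2 : f en2 = f st3.
  by rewrite fen2 fst3 {1 2}e1 label_step_opp step1 step3;
     case: (s); case: (t); case: (u).
have f3 : f en3 = f st1.
  by rewrite fen3 fst1 {1 2}e2 label_step_opp step1 step2;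
     case: (s); case: (t); case: (u).
have o1 : opp st2 = en1 by rewrite e1 oppK.
have o2 : opp st3 = en2 by rewrite e2 oppK.
have o3 : opp st1 = en3 by rewrite e3 oppK.
move=> x; rewrite !six; rewrite inE => /predU1P[->|].
  by rewrite -e1 f1 !inE !eqxx !orbT.
rewrite inE => /predU1P[->|]; first by rewrite o1 f1 !inE !eqxx.
rewrite inE => /predU1P[->|]; first by rewrite -e2 f2 !inE !eqxx !orbT.
rewrite inE => /predU1P[->|]; first by rewrite o2 f2 !inE !eqxx !orbT.
rewrite inE => /predU1P[->|]; first by rewrite -e3 f3 !inE !eqxx !orbT.
by rewrite inE => /eqP->; rewrite o3 f3 !inE !eqxx !orbT.
Qed.

Lemma perm_swap3 (T : eqType) (a b c d : seq T) p p' q q' r r' :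
  perm_eq (a ++ [:: p'; p] ++ b ++ [:: q'; q] ++ c ++ [:: r'; r] ++ d)
          (a ++ [:: p; p'] ++ b ++ [:: q; q'] ++ c ++ [:: r; r'] ++ d).
Proof.
have swap (x y : T) : perm_eq [:: x; y] [:: y; x] by apply/permPl/(perm_rev [:: y; x]).
by do 3 (apply: perm_cat => //; apply: perm_cat => //).
Qed.

Lemma perm_six (T : eqType) (a b c d : seq T) p p' q q' r r' :
  perm_eq (a ++ [:: p; p'] ++ b ++ [:: q; q'] ++ c ++ [:: r; r'] ++ d)
          ([:: p; p'; q; q'; r; r'] ++ a ++ b ++ c ++ d).
Proof.
apply/permP => P; rewrite !count_cat /= !addn0.
by move: (count _ _) (count _ _) (count _ _) (count _ _) (nat_of_bool _)
  (nat_of_bool _) (nat_of_bool _) (nat_of_bool _) (nat_of_bool _) (nat_of_bool _); lia.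
Qed.

(** Only the six swapped passes change height, each by plus or minus the step of the pass it is
    swapped with. As the triangle is a face, the two passes of each of its crossings shift equally,
    and every index is preserved. *)
Lemma index_poly_R3 closed a b c d p p' q q' r r'
    (w := a ++ [:: p; p'] ++ b ++ [:: q; q'] ++ c ++ [:: r; r'] ++ d) s t u :
  let i := (size a).+1 in
  let j := (size (a ++ [:: p; p'] ++ b)).+1 in
  let k := (size (a ++ [:: p; p'] ++ b ++ [:: q; q'] ++ c)).+1 in
  fcycle (turn closed w) [:: (i, s); (j, t); (k, u)]
    \/ fcycle (turn closed w) [:: (i, s); (k, u); (j, t)] ->
  all (fun x => ~~ virtual x) [:: p; p'; q; q'; r; r'] -> wf w ->
  index_poly (a ++ [:: p'; p] ++ b ++ [:: q'; q] ++ c ++ [:: r'; r] ++ d) =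
  index_poly w.
Proof.
move=> i j k cyc; rewrite [all _ _]/= => /and5P[cp cp' cq cq' /and3P[cr cr' _]] wfw.
have uw := wf_uniq wfw.
pose w' := a ++ [:: p'; p] ++ b ++ [:: q'; q] ++ c ++ [:: r'; r] ++ d.
pose six := [:: p; p'; q; q'; r; r'].
have ww' : perm_eq w' w := perm_swap3 _ _ _ _ _ _ _ _ _ _.
have u6 : uniq six.
  have : perm_eq w (six ++ a ++ b ++ c ++ d) := perm_six _ _ _ _ _ _ _ _ _ _.
  by move/perm_uniq; rewrite uw cat_uniq => /esym/andP[].
pose shift x : int :=
    (if x == r then label_step r' else if x == r' then - label_step r else 0)
  + (if x == q then label_step q' else if x == q' then - label_step q else 0)
  + (if x == p then label_step p' else if x == p' then - label_step p else 0).
have heightE x : height w' x = height w x + shift x.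
  have uniq_prefix w1 w2 : w = w1 ++ w2 -> uniq w1.
    by move=> wE; move: uw; rewrite wE cat_uniq => /andP[].
  have u1 : uniq (a ++ [:: p; p']).
    by apply: (uniq_prefix _ (b ++ [:: q; q'] ++ c ++ [:: r; r'] ++ d)); rewrite -!catA.
  have u2 : uniq ((a ++ [:: p; p'] ++ b) ++ [:: q; q']).
    by apply: (uniq_prefix _ (c ++ [:: r; r'] ++ d)); rewrite -!catA.
  have u3 : uniq ((a ++ [:: p; p'] ++ b ++ [:: q; q'] ++ c) ++ [:: r; r']).
    by apply: (uniq_prefix _ d); rewrite -!catA.
  rewrite /w' (height_swap _ _ u1).
  have := height_swap (c ++ [:: r'; r] ++ d) x u2; rewrite -!catA => ->.
  have := height_swap d x u3; rewrite -!catA => ->.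
  by rewrite /shift /w !addrA.
have shiftE :
  [/\ shift p = label_step p', shift q = label_step q' & shift r = label_step r']
  /\ [/\ shift p' = - label_step p, shift q' = - label_step q
       & shift r' = - label_step r].
  have ne (x y : pass) : x != y -> ((x == y) = false) * ((y == x) = false).
    by move=> /negPf xy; rewrite (eq_sym y) xy.
  move: u6; rewrite /= !inE !negb_or -!andbA.
  case/and5P=> /ne a1 /ne a2 /ne a3 /ne a4 /and5P[/ne a5 /ne b1 /ne b2 /ne b3].
  case/and5P=> /ne b4 /ne c1 /ne c2 /ne c3 /and4P[/ne d1 /ne d2 /ne e1 _].
  by split; split; rewrite /shift
    ?(a1, a2, a3, a4, a5, b1, b2, b3, b4, c1, c2, c3, d1, d2, e1) !eqxx ?addr0 ?add0r.
have shift0 x : x \notin six -> shift x = 0.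
  rewrite !inE !negb_or /shift.
  by case/and5P=> /negPf-> /negPf-> /negPf-> /negPf-> /andP[/negPf-> /negPf->].
have shift_opp x : x \in six -> (opp x \in six) && (shift x == shift (opp x)).
  move: x.
  have pass_at w1 w2 x y i0 : w = w1 ++ [:: x; y] ++ w2 -> i0 = (size w1).+1 ->
      [/\ nth_pass w i0 = y, nth_pass w i0.-1 = x
        & (0 < i0 < size w)%N].
    move=> -> ->; rewrite /= !nth_cat ltnn ltnNge leqnSn subSnn subnn.
    by rewrite size_cat /= !addnS !ltnS leq_addr.
  have [] := pass_at a (b ++ [:: q; q'] ++ c ++ [:: r; r'] ++ d) p p' i erefl erefl.
  have [] := pass_at (a ++ [:: p; p'] ++ b) (c ++ [:: r; r'] ++ d) q q' j _ erefl.
    by rewrite -!catA.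
  have [] := pass_at (a ++ [:: p; p'] ++ b ++ [:: q; q'] ++ c) d r r' k _ erefl.
    by rewrite -!catA.
  move=> wk wk' kb wj wj' jb wi wi' ib.
  case: cyc => /=.
    case/and4P=> /eqP t1 /eqP t2 /eqP t3 _.
    have := turn_opp wfw ib jb t1; have := turn_opp wfw jb kb t2.
    have := turn_opp wfw kb ib t3.
    rewrite !(fun_if (nth_pass w)) wi wi' wj wj' wk wk' => e3 e2 e1.
    apply: R3_shift e1 e2 e3; last by case: shiftE.
      by rewrite /= cp cp' cq cq' cr cr'.
    by case: shiftE.
  (* The face meets its sides in the other cyclic order, so [R3_shift] is applied with the last two
     sides exchanged. *)
  case/and4P=> /eqP t1 /eqP t2 /eqP t3 _.
  have := turn_opp wfw ib kb t1; have := turn_opp wfw kb jb t2.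
  have := turn_opp wfw jb ib t3.
  rewrite !(fun_if (nth_pass w)) wi wi' wj wj' wk wk' => e3 e2 e1.
  have sixE : six =i [:: p; p'; r; r'; q; q'].
    by move=> x; rewrite !inE; case: (x == p); case: (x == p'); case: (x == q);
       case: (x == q'); rewrite //= ?orbT ?orbF.
  move=> x; rewrite !sixE; move: x.
  have [[f1 f2 f3] [f4 f5 f6]] := shiftE.
  by apply: R3_shift e1 e2 e3; rewrite /= ?cp ?cp' ?cq ?cq' ?cr ?cr'.
apply: eq_index_poly ww' _ => x xw _.
apply: (loop_index_shift (s := shift x)); rewrite heightE //.
case: (boolP (x \in six)) => [/shift_opp/andP[_ /eqP->]|x6] //.
by rewrite !shift0 //; apply: contra x6 => /shift_opp; rewrite oppK => /andP[].
Qed.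

Lemma index_poly_move (D D' : virtual_diagram) :
  virtual_move D D' -> index_poly D = index_poly D'.
Proof.
have wfD := vd_wf D; have wfD' := vd_wf D'.
case=> [f inj_f ->|k ->|rm|u s u' s' DE DE' vs vs' eqe].
- by rewrite index_poly_rename.
- by rewrite index_poly_rot.
- case: rm wfD wfD' => [a b p _|a b c p q s cp lq rq sE|
      a b c d p p' q q' r r' w s t u i j k cyc cl _] wfD wfD'.
  + by rewrite index_poly_R1.
  + by rewrite (index_poly_R2 cp lq rq sE wfD').
  + by rewrite (index_poly_R3 cyc cl wfD).
- move: wfD wfD'; rewrite -index_poly_classical -[RHS]index_poly_classical.
  rewrite DE DE' => wfD wfD'.
  by rewrite -!classical_part_erase // eqe.
Qed.

Lemma index_poly_equiv (D D' : virtual_diagram) :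
  virtual_equiv D D' -> index_poly D = index_poly D'.
Proof.
by elim=> [x y /index_poly_move|x|x y _ ->|x y z _ -> _ ->].
Qed.

(** The closing arc carries only virtual crossings and [K] only classical ones. *)
Lemma closure_diagram_classical (K : knotoid_diagram) (D : virtual_diagram) :
  closure_diagram K D -> classical_part D = K.
Proof.
have wfD := vd_wf D; move=> [u [s [DE vs _ eK]]]; rewrite DE in wfD *.
rewrite -classical_part_erase // eK; apply/all_filterP; exact: kd_classical.
Qed.

(** * Knotoid diagrams on the sphere *)

Definition edge_height (w : seq pass) (i : nat) : int := total (take i w).

Lemma edge_height_index w p : p \in w -> edge_height w (index p w) = height w p.
Proof.
rewrite /edge_height /total; elim: w => //= y w IHw; rewrite inE eq_sym.
case: eqP => [_ _|_ /= pw]; first by rewrite big_nil.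
by rewrite big_cons IHw.
Qed.

Lemma edge_heightS w i : (i < size w)%N ->
  edge_height w i.+1 = edge_height w i + label_step (nth_pass w i).
Proof.
move=> iw; rewrite /edge_height (take_nth (Pass 0 None false)) // -cats1 total_cat.
by rewrite {2}/total big_seq1.
Qed.

Lemma turn_forward closed w i (p := nth_pass w i) :
  (i < size w)%N -> turn closed w (i, true) = (index (opp p) w + rtl p, rtl p)%N.
Proof. by case: i @p => [|i] p iw; rewrite /turn iw eqb_id. Qed.

Lemma turn_backward closed w i (p := nth_pass w i) :
  turn closed w (i.+1, false) = (index (opp p) w + ~~ rtl p, ~~ rtl p)%N.
Proof. by rewrite /turn eqbF_neg. Qed.

Lemma turn_head w i : (size w <= i)%N -> turn false w (i, true) = (i, false).
Proof. by case: i => [|i]; rewrite /turn ltnNge => ->. Qed.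

(** * The turning map as a permutation of the darts *)

Section Turn.
Variables (w : seq pass) (wfw : wf w).

Local Notation pass_at := (nth_pass w).
Local Notation partner i := (index (opp (pass_at i)) w).

Lemma pass_at_mem i : (i < size w)%N -> pass_at i \in w.
Proof. exact: mem_nth. Qed.

Lemma partner_lt i : (i < size w)%N -> (partner i < size w)%N.
Proof. by move=> iw; rewrite index_mem wf_opp // mem_nth. Qed.

Lemma pass_at_partner i : (i < size w)%N -> pass_at (partner i) = opp (pass_at i).
Proof. by move=> iw; rewrite nth_index // wf_opp // mem_nth. Qed.

Lemma partnerK i : (i < size w)%N -> partner (partner i) = i.
Proof. by move=> iw; rewrite pass_at_partner // oppK index_uniq // wf_uniq. Qed.

(** The left inverse of [turn false w] on the darts of the diagram; it makes [turn_dart] a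
    permutation, whose orbits are the faces. *)
Definition turn_back (d : nat * bool) : nat * bool :=
  match d with
  | (0, true) => (0, false)
  | (j.+1, true) => (partner j + rtl (pass_at j), ~~ rtl (pass_at j))%N
  | (j, false) => if (j < size w)%N then
       (partner j + ~~ rtl (pass_at j), rtl (pass_at j))%N else (j, true)
  end.

Lemma turnK i s : (i <= size w)%N -> turn_back (turn false w (i, s)) = (i, s).
Proof.
case: s => [|]; last case: i => [//|i] iw.
  case: (ltnP i (size w)) => [iw _|iw _]; last first.
    by rewrite turn_head //; case: i iw => [|i]; rewrite /= leqNgt => /negPf->.
  rewrite turn_forward //.
  have := partner_lt iw; have := pass_at_partner iw; have := partnerK iw.
  case r : (rtl (pass_at i)) => /=; rewrite ?addn1 ?addn0 /= => pK pE pw.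
    by rewrite pK pE /= r addn0.
  by rewrite /turn_back pw pK pE /= r /= addn0; case: (partner i).
rewrite turn_backward.
have := partner_lt iw; have := pass_at_partner iw; have := partnerK iw.
case r : (rtl (pass_at i)) => /=; rewrite ?addn1 ?addn0 /= => pK pE pw.
  by rewrite /turn_back pw pK pE /= r /= addn1; case: (partner i).
by rewrite pK pE /= r addn1.
Qed.

Lemma turn_le i s : (i <= size w)%N -> ((turn false w (i, s)).1 <= size w)%N.
Proof.
have le j (b : bool) : (j < size w)%N -> (partner j + b <= size w)%N.
  by move/partner_lt => jw; apply: leq_trans jw; rewrite -addn1 leq_add2l leq_b1.
case: s => [|]; last by case: i => [//|i] iw; rewrite turn_backward le.
by case: (ltnP i (size w)) => [iw _|iw]; [rewrite turn_forward ?le | rewrite turn_head].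
Qed.

Lemma turn_dartE (d : dart w) :
  (val (turn_dart false d).1, (turn_dart false d).2) = turn false w (val d.1, d.2).
Proof.
rewrite [RHS]surjective_pairing; congr (_, _); apply: inordK.
by rewrite ltnS turn_le // leq_ord.
Qed.

Lemma turn_dart_inj : injective (turn_dart false (w := w)).
Proof.
move=> d d' eqd; have := turn_dartE d; rewrite eqd turn_dartE.
move/(congr1 turn_back); rewrite !turnK ?leq_ord //.
by case: d d' {eqd} => [i s] [j t] /= -[/val_inj-> ->].
Qed.

(** * Twisted cochains on faces, edges and crossings *)

Section Field.
Variables (k : fieldType) (t : k) (t0 : t != 0) (t1 : t != 1).
Hypothesis cw : all (fun p => ~~ virtual p) w.

(** Constancy along face boundaries: [F (i, true)] is the value on the face to the left of edge [i],
    [F (i, false)] on the face to its right. *)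
Definition face_function (F : nat * bool -> k) :=
  forall i s, (i <= size w)%N -> F (turn false w (i, s)) = F (i, s).

(** One equation for each of the four quadrants around the crossing. *)
Lemma face_function_rtl F i : face_function F -> (i < size w)%N ->
    rtl (pass_at i) ->
  [/\ F (i, true) = F ((partner i).+1, true), F (i.+1, false) = F (partner i, false),
      F (i, false) = F (partner i, true) & F (i.+1, true) = F ((partner i).+1, false)].
Proof.
move=> FF iw r; have jw := partner_lt iw.
have := FF i true (ltnW iw); have := FF i.+1 false iw.
have := FF _ true (ltnW jw); have := FF (partner i).+1 false jw.
rewrite !turn_forward // !turn_backward pass_at_partner // oppK.
rewrite index_uniq ?wf_uniq //= r /=.
by rewrite ?addn0 !addn1.
Qed.

Definition coboundary (F : nat * bool -> k) i := t^-1 * F (i, false) - F (i, true).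

Lemma labelled_faces_symmetric F : face_function F ->
  (forall i, (i <= size w)%N -> coboundary F i = t ^ (- edge_height w i)) ->
  \sum_(p <- w | rtl p) t ^ loop_index w p =
  \sum_(p <- w | rtl p) t ^ (- loop_index w p).
Proof.
move=> FF dF; have tot0 := total_wf wfw.
pose Phi i := t ^ edge_height w i * F (i, true).
have h0 : edge_height w 0 = 0 by rewrite /edge_height take0 /total big_nil.
have hm : edge_height w (size w) = 0 by rewrite /edge_height take_size.
(* At either end the two sides of the edge are one face, where [(t^-1 - 1) * F = 1]; [t != 1] allows
   the division. *)
have Phi0m : Phi (size w) = Phi 0%N.
  rewrite /Phi h0 hm expr0z !mul1r.
  have tV1 : t^-1 - 1 != 0 by rewrite subr_eq0 invr_eq1.
  apply: (mulfI tV1).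
  have := dF 0%N isT; have := dF _ (leqnn (size w)).
  have := FF 0%N false isT; have := FF _ true (leqnn (size w)).
  rewrite turn_head // /coboundary h0 hm => <- <- em e0.
  by rewrite !mulrBl !mul1r em e0.
have PhiS i : (i < size w)%N -> Phi i.+1 - Phi i =
    (if rtl (pass_at i) then 1 else -1) * t ^ loop_index w (pass_at i).
  move=> iw; have jw := partner_lt iw.
  have pw := pass_at_mem iw; have ow : opp (pass_at i) \in w by rewrite wf_opp.
  rewrite /loop_index -!edge_height_index // index_uniq ?wf_uniq // /Phi edge_heightS //.
  have := edge_heightS jw; rewrite pass_at_partner // label_step_opp.
  rewrite /label_step (negPf (allP cw _ pw)).
  set h := edge_height w i; set h' := edge_height w (partner i).
  have tD (a b : int) : t ^ (a + b) = t ^ a * t ^ b by rewrite expfzDr.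
  have tN (a : int) : t ^ (- a) = (t ^ a)^-1 by rewrite invr_expz.
  have tz (a : int) : t ^ a != 0 by rewrite expfz_neq0.
  (* The faces left of edges [i] and [i.+1] are separated by an edge of the other strand: its
     outgoing edge if it crosses from right to left, its incoming edge otherwise. *)
  case: ifP => r h'S.
    have [e1 e2 e3 e4] := face_function_rtl FF iw r.
    have := dF _ jw; rewrite /coboundary h'S -e4 -e1 => e.
    have -> : F (i.+1, true) = t * (F (i, true) + t ^ (- (h' - -1))).
      by rewrite -e addrC subrK mulrA mulfV ?mul1r.
    rewrite !(tD, tN) expr1z; field.
    by rewrite t0 tz oner_neq0.
  have rj : rtl (pass_at (partner i)) by rewrite pass_at_partner //= r.
  have [] := face_function_rtl FF jw rj; rewrite partnerK // => e1 e2 e3 e4.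
  have := dF _ (ltnW jw); rewrite /coboundary e3 e1 => e.
  have -> : F (i, true) = t * (F (i.+1, true) + t ^ (- h')).
    by rewrite -e addrC subrK mulrA mulfV ?mul1r.
  rewrite !(tD, tN) expr1z; field.
  by rewrite ?t0 ?tz ?oner_neq0.
have : \sum_(p <- w) (if rtl p then 1 else -1) * t ^ loop_index w p = 0.
  rewrite (big_nth (Pass 0 None false)) -[RHS](subrr (Phi 0%N)) -{1}Phi0m.
  rewrite -telescope_sumr //; apply: eq_big_nat => i /andP[_ iw].
  by rewrite PhiS.
rewrite (bigID rtl) /=; under eq_bigr => p -> do rewrite mul1r.
under [X in _ + X]eq_bigr => p /negPf-> do rewrite mulN1r.
rewrite sumrN => /eqP; rewrite subr_eq0 => /eqP->.
(* Reindexing by [opp] turns the passes with [rtl] false into those with [rtl] true and negates the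
   index. *)
rewrite -[in LHS](perm_big _ (wf_perm_opp wfw)) big_map /=.
by apply: eq_big => p; rewrite /= ?negbK // loop_index_opp.
Qed.
(** [opp] exchanges the two values of [rtl]. Since each crossing has one [rtl] pass, this counts the
    crossings. *)
Lemma count_rtl : (count rtl w = (size w)./2)%N.
Proof.
have := permP (wf_perm_opp wfw) rtl; rewrite count_map => eqc.
have /= := count_predC rtl w; rewrite (eqc : count (predC rtl) w = _) => <-.
by rewrite addnn doubleK.
Qed.

Lemma face_function_exists : spherical false w ->
  exists2 F, face_function F &
    forall i, (i <= size w)%N -> coboundary F i = t ^ (- edge_height w i).
Proof.
set m := size w => sph; pose f := turn_dart false (w := w).
have symf := fconnect_sym turn_dart_inj.
have root_in : froot f (ord0, true) \in froots f by apply: roots_root.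
pose nF := #|froots f|.
pose face d : 'I_nF := enum_rank_in root_in (froot f d).
pose fn (u : 'rV[k]_nF) (d : nat * bool) := u 0 (face (inord d.1, d.2)).
have fn_face u : face_function (fn u).
  move=> i s im; rewrite /fn /face; congr (u _ (enum_rank_in _ _)).
  have /(fingraph.rootP symf) -> := fconnect1 f (inord i, s).
  by rewrite /f /turn_dart /= inordK.
(* A crossing is represented by its [rtl] pass, at position [gi c]; its other pass is at [gj c]. *)
pose crossing := [pred i : 'I_m | rtl (pass_at i)].
pose C := #|crossing|.
pose gi (c : 'I_C) : nat := enum_val c.
pose gj (c : 'I_C) : nat := partner (gi c).
have gi_lt c : (gi c < m)%N by apply: ltn_ord.
have gj_lt c : (gj c < m)%N by apply: partner_lt.
have gi_rtl c : rtl (pass_at (gi c)) by apply: (enum_valP c).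
have gj_rtl c : rtl (pass_at (gj c)) = false.
  by rewrite pass_at_partner //= gi_rtl.
have gi_inj : injective gi by move=> c c' /val_inj/enum_val_inj.
have gj_inj : injective gj.
  move=> c c' e; apply: gi_inj; rewrite -(partnerK (gi_lt c)) -(partnerK (gi_lt c')).
  by rewrite -/(gj c) -/(gj c') e.
have gij c c' : (gi c == gj c') = false.
  by apply/eqP => e; have := gi_rtl c; rewrite e gj_rtl.
(* The map from faces to edges, acting on row vectors: the matrix of [coboundary]. *)
pose A : 'M[k]_(nF, m.+1) := t^-1 *: colsub (fun e => face (e, false)) 1%:M
   - colsub (fun e => face (e, true)) 1%:M.
have mulA_coboundary u e : (e <= m)%N -> (u *m A) 0 (inord e) = coboundary (fn u) e.
  move=> em; rewrite mulmxBr -scalemxAr !mulmx_colsub mulmx1 !mxE.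
  by rewrite /coboundary /fn.
(* The map from edges to crossings; the coefficients are chosen so that the values on the four
   quadrants cancel in [A *m B]. *)
pose B : 'M[k]_(m.+1, C) :=
  colsub (fun c => inord (gi c)) 1%:M + t^-1 *: colsub (fun c => inord (gj c)) 1%:M
  - t^-1 *: colsub (fun c => inord (gi c).+1) 1%:M
  - colsub (fun c => inord (gj c).+1) 1%:M.
have mulB (x : 'rV_m.+1) c : (x *m B) 0 c =
    x 0 (inord (gi c)) + t^-1 * x 0 (inord (gj c))
    - t^-1 * x 0 (inord (gi c).+1) - x 0 (inord (gj c).+1).
  by rewrite !mulmxBr mulmxDr -!scalemxAr !mulmx_colsub mulmx1 !mxE.
have AB0 (u : 'rV_nF) : u *m A *m B = 0.
  apply/rowP => c; rewrite mulB !mulA_coboundary ?(ltnW (gi_lt c)) ?(ltnW (gj_lt c)) //.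
  have [e1 e2 e3 e4] := face_function_rtl (fn_face u) (gi_lt c) (gi_rtl c).
  rewrite /coboundary e1 e2 e3 e4 mxE; ring.
(* A function in the kernel vanishes at the tail, where both sides of the
   edge are the same face, and then along the whole curve. *)
have freeA : row_free A.
  apply: inj_row_free => u uA0.
  have dF0 e : (e <= m)%N -> fn u (e, true) = t^-1 * fn u (e, false).
    move=> em; apply/esym/eqP; rewrite -subr_eq0 -/(coboundary _ _) -mulA_coboundary //.
    by rewrite uA0 mxE.
  have dF0' e : (e <= m)%N -> fn u (e, true) = 0 -> fn u (e, false) = 0.
    move=> em /eqP; rewrite dF0 // mulf_eq0 invr_eq0 (negPf t0) /= => /eqP //.
  have fn0 e : (e <= m)%N -> fn u (e, true) = 0.
    elim: e => [_|e IHe em].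
      have := fn_face u 0%N false isT; rewrite /turn => e0.
      have := dF0 0%N isT; rewrite -e0 => /eqP.
      rewrite -subr_eq0 -{1}[fn u _]mul1r -mulrBl.
      by rewrite mulf_eq0 subr_eq0 eq_sym invr_eq1 (negPf t1) => /eqP.
    have /IHe {}IHe := ltnW em; have jm := partner_lt em.
    case r : (rtl (pass_at e)).
      have [e1 e2 e3 e4] := face_function_rtl (fn_face u) em r.
      by rewrite e4 dF0' // -e1.
    have rj : rtl (pass_at (partner e)) by rewrite pass_at_partner //= r.
    have [] := face_function_rtl (fn_face u) jm rj; rewrite partnerK // => e1 e2 e3 e4.
    by rewrite -e1 dF0 ?(ltnW jm) // e3 IHe mulr0.
  apply/rowP => c; rewrite mxE.
  have := enum_valP c; case E : (enum_val c) => [e s] cr.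
  have <- : face (e, s) = c.
    by rewrite /face -E (eqP (enum_valP c)); apply: enum_valK_in.
  have : fn u (val e, s) = 0 by case: s {E cr} => //; [|apply: dF0']; rewrite ?fn0 ?leq_ord.
  by rewrite /fn inord_val.
(* Following the curve, each pass is the first or the second visit to its
   crossing, and the equation of the incoming edge forces [y] to vanish there. *)
have freeB : row_free B^T.
  apply: inj_row_free => y yB0.
  have BE e c : (e <= m)%N -> B (inord e) c = (e == gi c)%:R + t^-1 * (e == gj c)%:R
      - t^-1 * (e == (gi c).+1)%:R - (e == (gj c).+1)%:R.
    have inord_eq i : (e <= m)%N -> (i <= m)%N ->
        (inord e == inord i :> 'I_m.+1) = (e == i).
      by move=> em im; rewrite -val_eqE /= !inordK.
    by move=> em; rewrite !mxE !inord_eq ?(ltnW (gi_lt c)) ?(ltnW (gj_lt c)).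
  suff y0 e c : (gi c == e) || (gj c == e) -> y 0 c = 0.
    by apply/rowP => c; rewrite mxE (y0 (gi c)) ?eqxx.
  elim/ltn_ind: e c => e IHe c ce.
  have em : (e < m)%N by case/orP: ce => /eqP<-.
  (* Edge [e] leaves a crossing visited at position [e - 1], which the induction hypothesis
     covers. *)
  have out0 c' : (e == (gi c').+1) || (e == (gj c').+1) -> y 0 c' = 0.
    by case/orP=> /eqP eE; [apply: (IHe (gi c')) | apply: (IHe (gj c'))];
       rewrite ?eqxx ?orbT // eE.
  have := congr1 (fun M : 'rV_m.+1 => M 0 (inord e)) yB0; rewrite !mxE.
  rewrite (bigD1 c) //= big1 ?addr0 => [|c' c'c]; rewrite mxE BE ?(ltnW em) //;
    [case: (boolP ((e == (gi c).+1) || (e == (gj c).+1))) => [/out0-> //|]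
    |case: (boolP ((e == (gi c').+1) || (e == (gj c').+1))) => [/out0->|]];
    rewrite ?mul0r // negb_or => /andP[/negPf-> /negPf->].
    case/orP: ce => /eqP<-; rewrite eqxx ?gij ?(eq_sym (gj _)) ?gij.
      by rewrite !mulr0 !subr0 addr0 mulr1.
    rewrite !mulr0 !subr0 add0r mulr1 => /eqP.
    by rewrite mulf_eq0 invr_eq0 (negPf t0) orbF => /eqP.
  case/orP: ce => /eqP<-.
    by rewrite (inj_eq gi_inj) eq_sym (negPf c'c) gij !mulr0 !subr0 addr0 mulr0.
  by rewrite (eq_sym _ (gi _)) gij (inj_eq gj_inj) (eq_sym c) (negPf c'c)
    !mulr0 !subr0 addr0 mulr0.
have sub_ker : (A <= kermx B)%MS.
  apply/sub_kermxP; rewrite -[A]mul1mx; apply/row_matrixP => i.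
  by rewrite !row_mul AB0 row0.
have CE : C = m./2.
  rewrite /C -sum1_card -count_rtl -sum1_count (big_nth (Pass 0 None false)) big_mkord.
  by apply: eq_bigl.
(* Euler's formula gives [nF = m + 1 - C], the rank of [A] on one side and the dimension of the
   kernel of [B] on the other. *)
have rkE : \rank A = \rank (kermx B).
  rewrite mxrank_ker -[\rank B]mxrank_tr (eqP freeA) (eqP freeB).
  move: sph; rewrite /spherical /faces -/m CE => /eqP.
  have -> : fcard (turn_dart false (w := w)) (dart w) = nF.
    by apply: eq_card => x; rewrite !inE andbT.
  lia.
have ker_sub : (kermx B <= A)%MS by rewrite -(mxrank_leqif_sup sub_ker) rkE.
(* The prescribed coboundary. It lies in the kernel of [B] because heights drop by 1 at [gi c] and
   rise by 1 at [gj c]. *)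
pose x : 'rV[k]_m.+1 := \row_e t ^ (- edge_height w e).
have xE e : (e <= m)%N -> x 0 (inord e) = t ^ (- edge_height w e).
  by move=> em; rewrite mxE inordK.
have /sub_kermxP : x *m B = 0.
  apply/rowP => c; rewrite mulB !xE ?(ltnW (gi_lt c)) ?(ltnW (gj_lt c)) // mxE.
  rewrite !edge_heightS // /label_step gi_rtl gj_rtl.
  rewrite !(negPf (allP cw _ (pass_at_mem _))) //.
  have tN (a : int) : t ^ (- a) = (t ^ a)^-1 by rewrite invr_expz.
  rewrite !(tN, expfzDr _ _ t0) expr1z; field.
  by rewrite t0 !expfz_neq0 ?oner_neq0.
move/submx_trans/(_ ker_sub)/submxP => [u xu].
by exists (fn u) => // i im; rewrite -mulA_coboundary // -xu xE.
Qed.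
End Field.
End Turn.

(** * From an identity in a field to Laurent coefficients *)

Lemma sum_exprz_inj (r s : seq int) :
  \sum_(a <- r) (tofrac 'X : {fraction {poly rat}}) ^ a =
  \sum_(a <- s) tofrac 'X ^ a ->
  forall n, \sum_(a <- r) (a == n)%:R = \sum_(a <- s) (a == n)%:R :> int.
Proof.
pose t := tofrac 'X : {fraction {poly rat}}; rewrite -/t.
have t0 : t != 0 by rewrite tofrac_eq0 polyX_eq0.
(* Multiplication by [t ^ N] makes all exponents, and [n] itself, nonnegative; then polynomial
   coefficients are compared. Over the rationals they determine the multiplicities. *)
move=> eqrs n; pose N := (\sum_(a <- n :: r ++ s) `|a|)%N.
have geN a : a \in n :: r ++ s -> 0 <= a + N.
  move=> ain; have : (`|a| <= N)%N by rewrite /N (big_rem a) //= leq_addr.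
  lia.
pose P (u : seq int) : {poly rat} := \sum_(a <- u) 'X^(absz (a + N)).
have PE u : {subset u <= r ++ s} -> tofrac (P u) = t ^ N * \sum_(a <- u) t ^ a.
  move=> sub; rewrite /P rmorph_sum mulr_sumr big_seq [RHS]big_seq.
  apply: eq_bigr => a /sub ain; rewrite rmorphXn /= -/t -expfzDr // (addrC N%:Z).
  by rewrite -[in RHS](@gez0_abs (a + N)) // geN // inE ain orbT.
have /eqP : tofrac (P r) = tofrac (P s).
  by rewrite !PE ?eqrs // => a ar; rewrite mem_cat ar ?orbT.
rewrite tofrac_eq => /eqP/(congr1 (fun p : {poly rat} => p`_(absz (n + N)))).
have PnE u : {subset u <= r ++ s} ->
    (P u)`_(absz (n + N)) = (\sum_(a <- u) (a == n))%:R.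
  move=> sub; rewrite /P coef_sum natr_sum; rewrite [LHS]big_seq [RHS]big_seq.
  apply: eq_bigr => a /sub ain; rewrite coefXn.
  have := geN a; have := geN n; rewrite !inE eqxx ain orbT => /(_ isT) + /(_ isT).
  by case: (a =P n) => [->|an] nN aN; rewrite ?eqxx //; case: eqP => //; lia.
rewrite !PnE; first by move/eqP; rewrite eqr_nat -!natr_sum => /eqP->.
  by move=> a ar; rewrite mem_cat ar orbT.
by move=> a ar; rewrite mem_cat ar.
Qed.

Lemma mcoeff_laurent_inv P n : (laurent_inv P)@_n = P@_(- n).
Proof.
rewrite /laurent_inv raddf_sum /=; under eq_bigr => a _ do rewrite mcoeffU eqr_oppLR.
case: (boolP (- n \in msupp P)) => [nP|nP].
  rewrite (big_fsetD1 (- n)) //= eqxx big1_fset ?addr0 // => a.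
  by rewrite !inE => /andP[/negPf->].
rewrite big1_seq ?mcoeff_outdom // => a /andP[_ aP].
by case: eqP aP nP => // -> ->.
Qed.

Lemma knotoid_index_poly_symmetric (K : knotoid_diagram) :
  laurent_inv (index_poly K) = index_poly K.
Proof.
have wfK := kd_wf K; have cK := kd_classical K.
(* An indeterminate differs from 0 and 1, and its powers are linearly independent. *)
pose t := tofrac 'X : {fraction {poly rat}}.
have t0 : t != 0 by rewrite tofrac_eq0 polyX_eq0.
have t1 : t != 1.
  rewrite -(rmorph1 (@tofrac _)) tofrac_eq -subr_eq0 -size_poly_eq0.
  by rewrite -['X - 1]/('X - 1%:P) size_XsubC.
have [F FF dF] := face_function_exists wfK t0 t1 cK (kd_spherical K).
have eqW := labelled_faces_symmetric wfK t0 t1 cK FF dF.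
have inj n : \sum_(p <- K | rtl p) (loop_index K p == n)%:R =
    \sum_(p <- K | rtl p) (- loop_index K p == n)%:R :> int.
  have := @sum_exprz_inj [seq loop_index K p | p <- K & rtl p]
    [seq - loop_index K p | p <- K & rtl p].
  by rewrite !big_map !big_filter => /(_ eqW n); rewrite !big_map !big_filter.
have coefE n : (index_poly K)@_n - (index_poly K)@_(- n) = 0.
  (* The contribution of a crossing to the difference of coefficients. Sign and index both change
     under [opp], so [g] does not, and the over pass may be replaced by the [rtl] pass, whose sign
     is 1. *)
  pose g p : int := crossing_sign p
    * ((loop_index K p == n)%:R - (- loop_index K p == n)%:R).
  have g_opp p : g (opp p) = g p.
    by rewrite /g crossing_sign_opp loop_index_opp opprK mulNr -mulrN opprB.
  have -> : (index_poly K)@_n - (index_poly K)@_(- n) = \sum_(p <- K | over p) g p.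
    rewrite /index_poly !raddf_sum -big_split; apply: eq_bigr => p _ /=.
    rewrite /crossing_term !mcoeffB !mcoeffU /g eqr_oppLR.
    have -> : (0 == - n) = (0 == n) by rewrite -{1}oppr0 eqr_opp.
    by rewrite mulrBr !mulr_natr opprB addrA subrK.
  rewrite (bigID rtl) /= [X in _ + X](_ : _ = \sum_(p <- K | rtl p && ~~ over p) g p).
    under eq_bigl => p do rewrite andbC.
    rewrite -bigID /=.
    under eq_bigr => p rp do rewrite /g /crossing_sign rp mul1r.
    by rewrite sumrB inj subrr.
  rewrite -(perm_big _ (wf_perm_opp wfK)) big_map /= big_seq_cond [RHS]big_seq_cond.
  apply: eq_big => p; last by rewrite g_opp.
  by case: (boolP (p \in _)) => //= /(allP cK)/over_opp->; rewrite andbC /= negbK.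
apply/malgP => n; rewrite mcoeff_laurent_inv; apply/esym/eqP.
by rewrite -subr_eq0 coefE.
Qed.

Theorem theorem4p11 (v : virtual_knot) (P : laurent)
    (hP : affine_index_polynomial v P) (hsym : P <> laurent_inv P) :
  ~ exists k : knotoid, is_virtual_closure k v.
Proof.
case=> k [K [D0 [_ cKD0 vD0]]]; case: hP => D [l [vD lab PE]].
have [D1 vE] := v_class v.
have eqD : index_poly D = index_poly D0.
  rewrite -(index_poly_equiv (iffLR (vE D) vD)).
  by rewrite (index_poly_equiv (iffLR (vE D0) vD0)).
have PK : P = index_poly K.
  rewrite PE (affine_indexE (vd_wf D) lab) eqD -index_poly_classical.
  by rewrite (closure_diagram_classical cKD0).
by apply: hsym; rewrite PK knotoid_index_poly_symmetric.
Qed.
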